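(* Let $N\subset\mathbb{R}^d$ be a rank $d$ lattice, $\tau\subset N_{\mathbb{R}}$ a strictly convex cone rational for the lattice $N$, and $\pi:N\to\mathbb{Z}^r$ a homomorphism of lattices for some $1\le r\le d$, whose extension $N_{\mathbb{R}}\to\mathbb{R}^r$ (also denoted $\pi$) satisfies $\tau\cap\ker\pi=\{0\}$. Let $\bar\tau:=\pi(\tau)$, $A:=\mathring\tau\cap N$ and $\bar A:=\pi(A)$. Then the generating function $F_{\bar A}(x)$ of $\bar A$ is of the form $$F_{\bar A}(x)=R_{\bar A}\prod_{\rho\le\tau,\ \dim\rho=1}\big(1-x^{\pi(\nu_\rho)}\big)^{-1},\qquad\text{for some }R_{\bar A}\in\mathbb{Z}[\bar\tau\cap\mathbb{Z}^r].$$
   Context: A cone means a rational convex polyhedral cone; $\mathring\tau$ is its relative interior; $\rho\le\tau$ means $\rho$ is a face of $\tau$; for an edge (one-dimensional face) $\rho$ of $\tau$, $\nu_\rho$ is the generator of the semigroup $\rho\cap N$. The condition $\tau\cap\ker\pi=\{0\}$ implies that $\bar\tau$ is strictly convex. The generating function of a set $B\subset\bar\tau\cap\mathbb{Z}^r$ is the formal series $F_B(x)=\sum_{a\in B}x^a\in\mathbb{Z}[[\bar\tau\cap\mathbb{Z}^r]]$. *)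

(* Defs.v *)
From HB Require Import structures.
From mathcomp Require Import all_boot all_order all_algebra finmap.
From mathcomp Require Import all_classical all_reals all_analysis.

Set Implicit Arguments.
Unset Strict Implicit.
Unset Printing Implicit Defensive.
Import Order.TTheory GRing.Theory Num.Theory.
Import numFieldNormedType.Exports.
Local Open Scope classical_set_scope.
Local Open Scope ring_scope.

(* The ring Z[[S]] makes sense as soon as every element of the monoid S is a
   sum of two elements of S in finitely many ways. *)
Record lfmonoid (G : zmodType) := LFMonoid {
  lfset : set G;
  lfset0 : lfset 0;
  lfsetD : forall a b, lfset a -> lfset b -> lfset (a + b);
  lfset_fin : forall a, finite_set [set b | lfset b /\ lfset (a - b)] }.

Section Series.
Variables (G : zmodType) (S : lfmonoid G).
Implicit Types (a b c : G) (f g h : G -> int).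

Definition supported_in : {pred G -> int} :=
  fun f => `[< forall a, ~ lfset S a -> f a = 0 >].

Lemma supported_inP f :
  reflect (forall a, ~ lfset S a -> f a = 0) (f \in supported_in).
Proof. exact: asboolP. Qed.

Fact supported_in_zmod_closed : zmod_closed supported_in.
Proof.
split; first exact/supported_inP.
move=> f g /supported_inP f0 /supported_inP g0; apply/supported_inP => a Sa.
have -> : (f - g) a = f a - g a by [].
by rewrite f0 // g0 // subrr.
Qed.
HB.instance Definition _ :=
  GRing.isZmodClosed.Build (G -> int) supported_in supported_in_zmod_closed.

Record fseries := FSeries { coef : G -> int; coefP : coef \in supported_in }.
HB.instance Definition _ := [isSub for coef].
HB.instance Definition _ := [Choice of fseries by <:].
HB.instance Definition _ := [SubChoice_isSubZmodule of fseries by <:].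

Lemma coef_out (F : fseries) a : ~ lfset S a -> coef F a = 0.
Proof. by move/supported_inP: (coefP F); exact. Qed.

Lemma fseriesP (F H : fseries) : coef F =1 coef H -> F = H.
Proof. by move=> e; apply/val_inj/funext. Qed.

Lemma coefD (F H : fseries) a : coef (F + H) a = coef F a + coef H a.
Proof. by []. Qed.

Lemma coefN (F : fseries) a : coef (- F) a = - coef F a.
Proof. by []. Qed.

Definition decomp a : set G := [set b | lfset S b /\ lfset S (a - b)].

Definition conv f g a : int := \sum_(b \in decomp a) f b * g (a - b).

Lemma decomp_fin a : finite_set (decomp a). Proof. exact: lfset_fin. Qed.

Lemma conv_supp (F H : fseries) : conv (coef F) (coef H) \in supported_in.
Proof.
apply/supported_inP => a Sa; rewrite /conv fsbig1 // => b [Sb Sab].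
by case: Sa; rewrite -(subrK b a); exact: lfsetD.
Qed.

Definition smul (F H : fseries) : fseries := FSeries (conv_supp F H).

Lemma coef_smul (F H : fseries) a :
  coef (smul F H) a = \sum_(b \in decomp a) coef F b * coef H (a - b).
Proof. by []. Qed.

(* Elements of B outside of S are ignored, so genfun B is the series F_B when
   B is included in S, and monom a is x^a when a is in S. *)
Definition indic (B : set G) a : int := (a \in B `&` lfset S)%:R.

Lemma indic_supp B : indic B \in supported_in.
Proof.
by apply/supported_inP => a Sa; rewrite /indic memNset // => -[].
Qed.

Definition genfun B : fseries := FSeries (indic_supp B).

Definition monom a : fseries := genfun [set a].

Lemma coef_monom a b : lfset S a -> coef (monom a) b = (b == a)%:R.
Proof.
move=> Sa; rewrite /= /indic; congr (_ %:R); congr nat_of_bool.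
by apply/idP/eqP => [|->]; rewrite inE => // -[].
Qed.

Lemma coef_smul_widen (F H : fseries) a (X : set G) : decomp a `<=` X ->
  coef (smul F H) a = \sum_(b \in X) coef F b * coef H (a - b).
Proof.
move=> DX; rewrite /= /conv; apply: fsbig_widen => // b [_ nD] /=.
have [Sb|Sb] := pselect (lfset S b); last by rewrite coef_out // mul0r.
have [Sab|Sab] := pselect (lfset S (a - b)); last by rewrite (coef_out H) // mulr0.
by case: nD.
Qed.

Lemma decomp_sub a e : decomp a e -> decomp e `<=` decomp a.
Proof.
move=> [Se Sae] b [Sb Seb]; split=> //.
by rewrite -(subrKA e) ; exact: lfsetD.
Qed.

Lemma smulC : commutative smul.
Proof.
move=> F H; apply: fseriesP => a; rewrite /= /conv.
have bij : set_bij (decomp a) (decomp a) (fun b => a - b).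
  split=> [b [Sb Sab]|b c _ _ /addrI/oppr_inj//|b [Sb Sab]].
    by split=> //; rewrite subKr.
  by exists (a - b) => //; rewrite /decomp /= subKr.
rewrite (reindex_fsbig (fun b => a - b) (decomp a)) //.
by apply: eq_fsbigr => b _; rewrite subKr mulrC.
Qed.

Lemma smulA : associative smul.
Proof.
move=> F H K; apply: fseriesP => a.
transitivity (\sum_(b \in decomp a) \sum_(e \in decomp a)
    coef F b * coef H (e - b) * coef K (a - e)).
  rewrite [LHS]coef_smul; apply: eq_fsbigr => b; rewrite inE.
  move=> [Sb Sab].
  have -> : \sum_(e \in decomp a) coef F b * coef H (e - b) * coef K (a - e)
     = coef F b * \sum_(e \in decomp a) coef H (e - b) * coef K (a - e).
    by rewrite mulr_fsumr; apply: eq_fsbigr => e _; rewrite mulrA.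
  congr (_ * _).
  pose X := [set e - b | e in decomp a].
  rewrite (@coef_smul_widen _ _ _ X); last first.
    move=> c [Sc Sc']; exists (c + b); last by rewrite addrK.
    by split; [exact: lfsetD|rewrite opprD addrCA addrC].
  rewrite (reindex_fsbig (fun e => e - b) (decomp a)) //.
    by apply: eq_fsbigr => e _; rewrite opprB addrA subrK.
  by split=> [e De|e e' _ _ /addIr//|]; [exists e|].
rewrite exchange_fsbig; [|exact: decomp_fin..].
rewrite [RHS]coef_smul; apply: eq_fsbigr => e; rewrite inE => De.
by rewrite (coef_smul_widen _ _ (decomp_sub De)) mulr_fsuml.
Qed.

Lemma smulDl : left_distributive smul +%R.
Proof.
move=> F H K; apply: fseriesP => a; rewrite coefD !coef_smul.
rewrite -fsbig_split; last exact: decomp_fin.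
by apply: eq_fsbigr => b _; rewrite coefD mulrDl.
Qed.

Lemma smul1 : left_id (monom 0) smul.
Proof.
move=> F; apply: fseriesP => a; have S0 := lfset0 S.
rewrite (@coef_smul_widen _ _ _ setT) //.
rewrite -(@fsbig_widen _ _ _ _ [set 0]) // => [|b [_ /eqP b0]]; last first.
  by rewrite /preimage /mkset coef_monom // (negbTE b0) mul0r.
by rewrite fsbig_set1 coef_monom // eqxx mul1r subr0.
Qed.

Lemma smonom0_neq0 : monom 0 != 0.
Proof.
apply/eqP => /(congr1 (fun F => coef F 0)).
by rewrite coef_monom ?eqxx //; exact: lfset0.
Qed.

HB.instance Definition _ := GRing.Zmodule_isComNzRing.Build fseries
  smulA smulC smul1 smulDl smonom0_neq0.

Definition sunit : {pred fseries} := fun F => `[< exists H, H * F = 1 >].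
Definition sinv (F : fseries) : fseries :=
  if pselect (exists H, H * F = 1) is left e then sval (cid e) else F.

Fact sinvl : {in sunit, left_inverse 1 sinv *%R}.
Proof.
move=> F; rewrite unfold_in /sinv => /asboolP e.
by case: pselect => // e'; case: (cid e').
Qed.
Fact sunitPl (F H : fseries) : H * F = 1 -> F \in sunit.
Proof. by move=> e; apply/asboolP; exists H. Qed.
Fact sinv_out : {in [predC sunit], sinv =1 id}.
Proof.
move=> F; rewrite inE unfold_in /sinv => /asboolP e.
by case: pselect.
Qed.
HB.instance Definition _ := GRing.ComNzRing_hasMulInverse.Build fseries
  sinvl sunitPl sinv_out.

(* Z[S] as a subset of Z[[S]]. *)
Definition is_poly (F : fseries) : Prop := finite_set [set a | coef F a != 0].

End Series.

Section Monom.
Variables (G : zmodType) (S : lfmonoid G).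
Implicit Types a b c v : G.

Lemma coef_monomM (F : fseries S) v a :
  lfset S v -> coef (monom S v * F) a = coef F (a - v).
Proof.
move=> Sv; rewrite (@coef_smul_widen _ _ _ _ _ setT) //.
rewrite -(@fsbig_widen _ _ _ _ [set v]) // => [|b [_ /eqP bv]]; last first.
  by rewrite /preimage /mkset coef_monom // (negbTE bv) mul0r.
by rewrite fsbig_set1 coef_monom // eqxx mul1r.
Qed.

(* The factors 1 - x^v are invertible in Z[[S]], with inverse the geometric
   series, as soon as v is not invertible in the monoid S. *)
Lemma monom_unit v :
  lfset S v -> ~ lfset S (- v) -> 1 - monom S v \is a GRing.unit.
Proof.
move=> Sv SNv; apply/asboolP.
exists (genfun S [set v *+ k | k in [set: nat]]); rewrite mulrC mulrBl mul1r.
have Sk k : lfset S (v *+ k).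
  by elim: k => [|k IH]; [exact: lfset0|rewrite mulrS; exact: lfsetD].
have cE a : coef (genfun S [set v *+ k | k in [set: nat]]) a
          = (a \in [set v *+ k | k in [set: nat]])%:R.
  rewrite /= /indic; congr (_ %:R); congr nat_of_bool.
  apply/idP/idP; rewrite !inE; first by case.
  by case=> k _ <-; split=> //; exists k.
apply: fseriesP => a; rewrite coefD coefN coef_monomM // !cE.
rewrite coef_monom; last exact: lfset0.
have [->|a0] := eqVneq a 0.
  rewrite mem_set; last by exists 0%N.
  by rewrite memNset ?subr0 // sub0r => -[k _ kv]; apply: SNv; rewrite -kv.
apply/eqP; rewrite subr_eq0; apply/eqP; congr (_ %:R); congr nat_of_bool.
apply/idP/idP; rewrite !inE => -[k _ kv].
  case: k kv => [|k] kv; first by move/eqP: a0; case; rewrite -kv mulr0n.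
  by exists k => //; rewrite -kv mulrS addrAC subrr add0r.
by exists k.+1 => //; rewrite mulrS kv addrC subrK.
Qed.

End Monom.

Section Cones.
Variables (R : realType) (d : nat).
Implicit Types (N L T C tau rho : set 'rV[R]_d).

Definition int_pt (a : 'rV[int]_d) : 'rV[R]_d := map_mx intr a.

Definition full_lattice N : Prop :=
  exists2 B : 'M[R]_d, B \in unitmx
    & N = [set int_pt c *m B | c in [set: 'rV[int]_d]].

Definition cone_hull n (v : 'I_n -> 'rV[R]_d) : set 'rV[R]_d :=
  [set x | exists2 l : 'I_n -> R,
    forall i, 0 <= l i & x = \sum_(i < n) l i *: v i].

Definition rational_cone L C : Prop :=
  exists n (v : 'I_n -> 'rV[R]_d), (forall i, L (v i)) /\ C = cone_hull v.

Definition strictly_convex C : Prop := forall x, C x -> C (- x) -> x = 0.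

Definition aff_hull T : set 'rV[R]_d :=
  [set x | exists n (v : 'I_n -> 'rV[R]_d) (l : 'I_n -> R),
    [/\ forall i, T (v i), \sum_(i < n) l i = 1
      & x = \sum_(i < n) l i *: v i]].

Definition relint T : set 'rV[R]_d :=
  [set x | T x /\ within (aff_hull T) (nbhs x) T].

(* Faces are the traces of supporting hyperplanes; u = 0 gives tau itself. *)
Definition face rho tau : Prop :=
  exists2 u : {scalar 'rV[R]_d},
    forall x, tau x -> 0 <= u x & rho = tau `&` [set x | u x = 0].

(* U is the linear span of T. *)
Definition has_dim T (k : nat) : Prop :=
  exists2 U : {vspace 'rV[R]_d}, \dim U = k
    & forall W : {vspace 'rV[R]_d}, T `<=` [set` W] <-> (U <= W)%VS.

Definition edges tau : set (set 'rV[R]_d) :=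
  [set rho | face rho tau /\ has_dim rho 1].

(* Such a v is unique when it exists, as it does for an edge rho of a strictly
   convex cone rational for N. *)
Definition edge_gen N rho : 'rV[R]_d :=
  xget 0 [set v | rho `&` N = [set v *+ k | k in [set: nat]]].

End Cones.

(* pi is a homomorphism of groups from N to Z^r, where pi is a function on R^d
   whose values outside of N are irrelevant. *)
Definition lattice_hom (R : realType) (d r : nat) (N : set 'rV[R]_d)
    (pi : 'rV[R]_d -> 'rV[int]_r) : Prop :=
  forall x y, N x -> N y -> pi (x + y) = pi x + pi y.

Definition real_extension (R : realType) (d r : nat) (N : set 'rV[R]_d)
    (pi : 'rV[R]_d -> 'rV[int]_r) (piR : 'rV[R]_d -> 'rV[R]_r) : Prop :=
  forall x, N x -> piR x = int_pt R (pi x).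

Section LatticePoints.
Variables (R : realType) (r : nat) (L C : set 'rV[R]_r).
Hypotheses (hC : rational_cone L C) (sC : strictly_convex C).

Definition lattice_points : set 'rV[int]_r := [set a | C (int_pt R a)].

Lemma cone0 : C 0.
Proof.
case: hC => n [v [_ ->]]; exists (fun=> 0) => //.
by rewrite big1 // => i _; rewrite scale0r.
Qed.

Lemma coneD x y : C x -> C y -> C (x + y).
Proof.
case: hC => n [v [_ ->]] [l l0 ->] [m m0 ->].
exists (fun i => l i + m i) => [i|]; first exact: addr_ge0.
by rewrite -big_split; apply: eq_bigr => i _; rewrite scalerDl.
Qed.

Lemma lattice_points0 : lattice_points 0.
Proof. by rewrite /lattice_points /= /int_pt map_mx0; exact: cone0. Qed.

Lemma lattice_pointsD a b :
  lattice_points a -> lattice_points b -> lattice_points (a + b).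
Proof. by rewrite /lattice_points /= /int_pt map_mxD; exact: coneD. Qed.

End LatticePoints.

Section Pointed.
Variables (R : realType) (r : nat).

Lemma pointed_bound n (v : 'I_n -> 'rV[R]_r) :
  (forall i, v i != 0) -> strictly_convex (cone_hull v) ->
  exists2 e : R, 0 < e & forall l : 'I_n -> R, (forall i, 0 <= l i) ->
    e * (\sum_(i < n) l i) <= `|\sum_(i < n) l i *: v i|.
Proof.
move=> v0 sv.
pose f (l : 'rV[R]_n) := `|\sum_(i < n) l ord0 i *: v i|.
pose K := [set l : 'rV[R]_n | forall i, `[0, 1]%classic (l ord0 i)] `&`
          [set l : 'rV[R]_n | \sum_(i < n) l ord0 i = 1].
have KP (l : 'I_n -> R) : (forall i, 0 <= l i) -> 0 < \sum_(i < n) l i ->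
    K (\row_i (l i / \sum_(i < n) l i)).
  move=> l0 s0; split=> [i|] /=.
    rewrite mxE in_itv /= divr_ge0 ?(ltW s0) //= ler_pdivrMr // mul1r.
    by rewrite (bigD1 i) //= lerDl sumr_ge0.
  under eq_bigr do rewrite mxE.
  by rewrite -mulr_suml divff // gt_eqF.
have fP (l : 'I_n -> R) : 0 < \sum_(i < n) l i ->
    f (\row_i (l i / \sum_(i < n) l i)) =
    `|\sum_(i < n) l i *: v i| / \sum_(i < n) l i.
  move=> s0; rewrite /f.
  under eq_bigr do rewrite mxE mulrC -scalerA.
  by rewrite -scaler_sumr normrZ gtr0_norm ?invr_gt0 // mulrC.
have s_ge0 (l : 'I_n -> R) : (forall i, 0 <= l i) -> 0 <= \sum_(i < n) l i.
  by move=> l0; exact: sumr_ge0.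
have [K0|/nonemptyPn K0] := pselect (K !=set0); last first.
  exists 1 => // l l0; have := s_ge0 l l0; rewrite le_eqVlt => /predU1P[<-|s0].
    by rewrite mulr0.
  by have := KP l l0 s0; rewrite K0.
have cK : compact K.
  apply: compact_closedI.
    exact: (@rV_compact R n (fun=> `[0, 1]%classic)
              (fun=> @segment_compact _ 0 1)).
  apply: (@preimage_closed _ _ (fun l : 'rV[R]_n => \sum_(i < n) l ord0 i)
           [set x | x = 1]).
    move=> l _; apply: (continuous_big add_continuous) => i _.
    exact: coord_continuous.
  exact: closed_eq.
have cf : {within K, continuous f}.
  apply: continuous_subspaceT => l; apply: continuous_comp; last first.
    exact: norm_continuous.
  apply: (continuous_big add_continuous) => i _ x.
  apply: (@continuous_comp _ _ _ (fun l : 'rV[R]_n => l ord0 i)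
    (fun k : R => k *: v i)); first exact: coord_continuous.
  exact: scalel_continuous.
have [c /set_mem [c01 c1] fc] := compact_EVT_min K0 cK cf.
have c0 i : 0 <= c ord0 i by have := c01 i; rewrite /= in_itv => /andP[].
exists (f c) => [|l l0]; last first.
  have := s_ge0 l l0; rewrite le_eqVlt => /predU1P[<-|s0].
    by rewrite mulr0.
  by rewrite -ler_pdivlMr // -fP // fc // inE; exact: KP.
rewrite /f normr_gt0; apply/eqP => cv.
have [i ci] : exists i, c ord0 i != 0.
  apply/existsP; rewrite -[X in is_true X]negbK negb_exists.
  apply/negP => /forallP h.
  have : \sum_(i < n) c ord0 i = 0.
    by apply: big1 => i _; apply/eqP; have := h i; rewrite negbK.
  by rewrite c1 => /eqP; rewrite oner_eq0.
suff : c ord0 i *: v i = 0.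
  by move/eqP; rewrite scaler_eq0 (negbTE ci) (negbTE (v0 i)).
apply: sv.
  exists (fun j => if j == i then c ord0 i else 0) => [j|].
    by case: ifP.
  rewrite (bigD1 i) //= eqxx big1 ?addr0 // => j /negbTE ->.
  by rewrite scale0r.
exists (fun j => if j == i then 0 else c ord0 j) => [j|]; first by case: ifP.
move: cv; rewrite (bigD1 i) //= => /eqP; rewrite addr_eq0 => /eqP ->.
rewrite opprK [RHS](bigD1 i) //= eqxx scale0r add0r.
by apply: eq_bigr => j /negbTE ->.
Qed.

Lemma finite_box (m : nat) :
  finite_set [set b : 'rV[int]_r | forall i, `|b ord0 i| <= m%:Z].
Proof.
pose h (f : {ffun 'I_r -> 'I_(m + m).+1}) : 'rV[int]_r :=
  \row_i ((f i : nat)%:Z - m%:Z).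
apply: (@sub_finite_set _ _ (h @` setT)); last first.
  by apply: finite_image; exact: finite_finset.
move=> b bm; exists [ffun i => inord (absz (b ord0 i + m%:Z)%R)] => //.
apply/rowP => i; rewrite mxE ffunE.
have := bm i; rewrite ler_norml => /andP[b1 b2].
have b0 : 0 <= b ord0 i + m%:Z by rewrite -lerBlDr sub0r.
rewrite inordK.
  by rewrite gez0_abs // addrK.
by rewrite ltnS -lez_nat gez0_abs // PoszD lerD2r.
Qed.

Lemma cone_hull_neq0 n (v : 'I_n -> 'rV[R]_r) :
  exists m (w : 'I_m -> 'rV[R]_r), (forall i, w i != 0) /\
    cone_hull v = cone_hull w.
Proof.
pose P := [pred i | v i != 0].
have sumP (l : 'I_n -> R) :
    \sum_(i < n) l i *: v i = \sum_(i < #|P|) l (enum_val i) *: v (enum_val i).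
  rewrite -(big_enum_val (fun i => l i *: v i)) [RHS]big_mkcond /=.
  apply: eq_bigr => i _; rewrite inE; case: eqP => //= ->; exact: scaler0.
exists #|P|, (fun i => v (enum_val i)); split.
  by move=> i; have := enum_valP i.
apply/seteqP; split=> x [l l0 ->].
  by exists (fun i => l (enum_val i)) => // ; exact: sumP.
exists (fun i => \sum_(j < #|P| | enum_val j == i) l j) => [i|].
  exact: sumr_ge0.
rewrite (partition_big (fun j : 'I_#|P| => enum_val j) xpredT) //=.
by apply: eq_bigr => i _; rewrite scaler_suml; apply: eq_bigr => j /eqP ->.
Qed.

Lemma lattice_points_fin (L C : set 'rV[R]_r) :
  rational_cone L C -> strictly_convex C ->
  forall a, finite_set [set b | lattice_points C b /\ lattice_points C (a - b)].
Proof.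
move=> [n' [v' [_ ->]]] sC a.
have [n [v [v0 vE]]] := cone_hull_neq0 v'; rewrite {}vE in sC *.
have [e e0 he] := pointed_bound v0 sC.
pose M := (\sum_(i < n) `|v i|) * (`|int_pt R a| / e).
apply: (@sub_finite_set _ _ _ _ (finite_box (Num.bound M))).
move=> b [[l l0 bE] [m m0 abE]] i.
have aE : int_pt R a = \sum_(i < n) (l i + m i) *: v i.
  under eq_bigr do rewrite scalerDl.
  by rewrite big_split /= -bE -abE /int_pt -map_mxD addrC subrK.
have sl : \sum_(i < n) (l i + m i) <= `|int_pt R a| / e.
  rewrite ler_pdivlMr // mulrC aE; apply: he => j; exact: addr_ge0.
have lj j : l j <= `|int_pt R a| / e.
  apply: le_trans sl; rewrite (bigD1 j) //= -addrA lerDl.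
  by rewrite addr_ge0 // sumr_ge0 // => k _; rewrite addr_ge0.
have bM : `|int_pt R b| <= M.
  rewrite bE /M mulr_suml; apply: le_trans (ler_norm_sum _ _ _) _.
  apply: ler_sum => j _; rewrite normrZ mulrC ler_wpM2l //.
  by rewrite ger0_norm.
have biM : `|(b ord0 i)%:~R : R| <= M.
  apply: le_trans bM; rewrite -[leRHS]/(mx_norm _) mx_normrE.
  have -> : (b ord0 i)%:~R = int_pt R b ord0 i by rewrite mxE.
  by have := @le_bigmax _ R _ 0 (fun j : 'I_1 * 'I_r => `|int_pt R b j.1 j.2|)
    (ord0, i).
rewrite -(ler_int R) intr_norm; apply: le_trans biM _.
by apply: ltW; apply: archi_boundP; apply: le_trans (normr_ge0 _) bM.
Qed.

End Pointed.

Definition lattice_monoid (R : realType) (r : nat) (L C : set 'rV[R]_r)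
    (hC : rational_cone L C) (sC : strictly_convex C) : lfmonoid 'rV[int]_r :=
  LFMonoid (lattice_points0 hC) (lattice_pointsD hC) (lattice_points_fin hC sC).

Section Image.
Variables (R : realType) (d r : nat) (N tau : set 'rV[R]_d).
Variable f : {linear 'rV[R]_d -> 'rV[R]_r}.

Lemma rational_cone_image :
  rational_cone N tau -> rational_cone (f @` N) (f @` tau).
Proof.
move=> [n [v [Nv ->]]]; exists n, (fun i => f (v i)); split=> [i|].
  by exists (v i).
apply/seteqP; split=> x.
  move=> [_ [l l0 ->] <-]; exists l => //.
  by rewrite linear_sum; apply: eq_bigr => i _; rewrite linearZ.
move=> [l l0 ->]; exists (\sum_(i < n) l i *: v i); first by exists l.
by rewrite linear_sum; apply: eq_bigr => i _; rewrite linearZ.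
Qed.

Lemma strictly_convex_image :
  rational_cone N tau -> strictly_convex tau ->
  tau `&` [set x | f x = 0] = [set 0] -> strictly_convex (f @` tau).
Proof.
move=> tauR tauS kf _ [x tx <-] [y ty fy].
have txy : (tau `&` [set x | f x = 0]) (x + y).
  split; first exact: coneD tauR _ _ tx ty.
  by rewrite /= linearD fy subrr.
move: txy; rewrite kf /= => /eqP; rewrite addr_eq0 => /eqP xy.
by rewrite (tauS x) ?linear0 // xy opprK.
Qed.

End Image.

(* In particular a product over edges tau is never truncated to 1 by the
   convention for infinite supports in \big[_/_]_(_ \in _). *)
Lemma finite_edges (R : realType) (d : nat) (N tau : set 'rV[R]_d) :
  rational_cone N tau -> finite_set (edges tau).
Proof.
move=> [n [v [_ tauE]]].
pose h (I : {set 'I_n}) := [set x | exists2 l : 'I_n -> R,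
  forall i, 0 <= l i & (forall i, i \notin I -> l i = 0) /\
                      x = \sum_(i < n) l i *: v i].
apply: (@sub_finite_set _ _ (h @` setT)); last first.
  by apply: finite_image; exact: finite_finset.
move=> rho [[u u0 ->] _]; exists [set i | u (v i) == 0]%SET => //.
have tv i : tau (v i).
  rewrite tauE; exists (fun j => (j == i)%:R) => [j|]; first exact: ler0n.
  rewrite (bigD1 i) //= eqxx scale1r big1 ?addr0 // => j /negbTE ->.
  by rewrite scale0r.
apply/seteqP; split=> x.
  move=> [l l0 [lI ->]]; split; first by rewrite tauE; exists l.
  rewrite /= linear_sum big1 // => i _; rewrite linearZ /=.
  case: (eqVneq (u (v i)) 0) => [->|ui]; first by rewrite mulr0.
  by rewrite lI ?mul0r // inE.
move=> [+ /= ux]; rewrite tauE => -[l l0 xE]; exists l => //; split=> // i.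
rewrite inE => ui; move: ux; rewrite xE linear_sum /= => /eqP.
have lu j : 0 <= u (l j *: v j).
  by rewrite linearZ /= mulr_ge0 // u0.
rewrite psumr_eq0 // => /allP /(_ i); rewrite mem_index_enum => /(_ isT).
by rewrite linearZ /= mulf_eq0 (negbTE ui) orbF => /eqP.
Qed.

(* Main.v *)
From HB Require Import structures.
Require Import Defs.
From mathcomp Require Import all_boot all_order all_algebra finmap.
From mathcomp Require Import all_classical all_reals all_analysis.
From mathcomp Require Import ring lra.
Set Implicit Arguments.
Unset Strict Implicit.
Unset Printing Implicit Defensive.
Import Order.TTheory GRing.Theory Num.Theory.
Import numFieldNormedType.Exports.
Local Open Scope classical_set_scope.
Local Open Scope ring_scope.

(** Put v_rho := pi (nu_rho). Two facts about A carry the proof: it is stable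
    under addition of the nu_rho, because a relative interior point plus a point
    of the cone is again a relative interior point (relintD); and it lies in
    tau `&` N, which by Gordan's lemma is covered by finitely many translates of
    the semigroup generated by the nu_rho: round down the coefficients of a point
    with respect to the nu_rho and observe that the remainders form a bounded,
    hence finite, set of lattice points (fractional_decomposition,
    finite_lattice_zonotope). Both facts pass to the image under pi, so Abar is
    a subset, stable under the v_rho, of a finitely generated set of exponents.

    The rest is the theorem of Hilbert and Serre, carried out on exponents
    instead of graded modules. A stable subset of a finitely generated set is
    finitely generated, just as a submodule of a noetherian module is
    (semigen_noetherian). If U is finitely generated over v :: s then
    (1 - x^v) F_U is the generating function of U minus its translate U + v.
    This difference consists of the elements of U' outside U' `&` (U + v),
    where U' has the same generators as U but uses only s. Both of these sets
    are finitely generated over s, so that induction on the number of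
    generators shows that F_U times the product of all the 1 - x^v is a
    polynomial (hilbert_serre).

    It remains to see that the edges, which are defined as one-dimensional
    exposed faces, generate tau (cone_generated_by_edges). In an irredundant
    list of generators, each member w is exposed: modulo the line through w,
    the other generators have no nontrivial nonnegative relation, since such a
    relation would contradict irredundancy or strict convexity, and then
    Gordan's theorem of the alternative gives a linear form that vanishes at w
    and is positive on the others (extreme_generator_exposed). *)

(** * Finitely generated sets of exponents *)

Lemma finite_uniform_bound (T : choiceType) (Q : set T) (H : nat -> set T) :
  finite_set Q -> {homo H : i j / (i <= j)%N >-> i `<=` j} ->
  Q `<=` \bigcup_j H j -> exists J, Q `<=` H J.
Proof.
move=> /finite_seqP[q ->] Hmono; elim: q => [|a q IH] QH.
  by exists 0%N => b; rewrite /= inE.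
have [b bq|J HJ] := IH; first by apply: QH; rewrite /= inE (bq : b \in q) orbT.
have [j _ Hj] := QH a (mem_head _ _).
exists (maxn j J) => b; rewrite /= inE => /predU1P[->|bq].
  exact: Hmono (leq_maxl _ _) _ Hj.
exact: Hmono (leq_maxr _ _) _ (HJ _ bq).
Qed.

Section Translates.
Variable G : zmodType.
Implicit Types (a v : G) (s : seq G) (P Q V : set G).

(** The translates of P by the semigroup generated by s, with one generator
    split off at a time, which is the shape of the inductions below. *)
Fixpoint semigen s P : set G :=
  if s is v :: s' then [set a | exists n, semigen s' P (a - v *+ n)] else P.

Definition stable s V := forall v a, v \in s -> V a -> V (a + v).

Lemma stable_muln s V v a n : stable s V -> v \in s -> V a -> V (a + v *+ n).
Proof.
by move=> sV vs Va; elim: n => [|n IH]; rewrite ?addr0 // mulrSr addrA; apply: sV.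
Qed.

Lemma semigen_base s P : P `<=` semigen s P.
Proof. by elim: s => //= v s IH a Pa; exists 0%N; rewrite subr0; apply: IH. Qed.

Lemma semigen_min s P V : stable s V -> P `<=` V -> semigen s P `<=` V.
Proof.
elim: s => //= v s IH sV PV a [n /IH Va].
rewrite -(subrK (v *+ n) a); apply: (stable_muln n sV); rewrite ?mem_head //.
by apply: Va => // w b ws; apply: sV; rewrite inE ws orbT.
Qed.

Lemma semigen_stable s P : stable s (semigen s P).
Proof.
elim: s => //= v s IH w a; rewrite inE => /predU1P[->|ws] [n an].
  by exists n.+1; rewrite mulrSr opprD addrACA subrr addr0.
by exists n; rewrite addrAC; apply: IH.
Qed.

Lemma semigen_sum (I : Type) (r : seq I) (f : I -> G) (n : I -> nat) P a :
  P a -> semigen (map f r) P (a + \sum_(i <- r) f i *+ n i).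
Proof.
move=> Pa; elim: r => [|i r IH] /=; first by rewrite big_nil addr0.
by exists (n i); rewrite big_cons addrCA addrAC subrr add0r.
Qed.

(** Hilbert's basis theorem for sets of exponents. With respect to the first
    generator v, the set V is cut into slices W j, consisting of the base points
    u for which u + j v lies in V. These increase with j, each of them is
    finitely generated by induction, and they are constant from some J on since
    their union is finitely generated; so the generators of W 0, ..., W J,
    shifted by the corresponding multiples of v, generate V. *)
Lemma semigen_noetherian s P V : finite_set P -> stable s V ->
  V `<=` semigen s P -> exists2 Q, finite_set Q & V = semigen s Q.
Proof.
move=> finP; elim: s V => [|v s IH] V sV VP /=.
  by exists V => //; apply: sub_finite_set finP.
pose W j := [set u | semigen s P u /\ V (u + v *+ j)].
have sV' w a : w \in s -> V a -> V (a + w).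
  by move=> ws; apply: sV; rewrite inE ws orbT.
have sW j : stable s (W j).
  move=> w a ws [aP aV]; split; first exact: semigen_stable.
  by rewrite addrAC; apply: sV'.
have Wmono : {homo W : i j / (i <= j)%N >-> i `<=` j}.
  move=> i j ij a [aP aV]; split=> //.
  rewrite -(subnKC ij) mulrnDr addrA; apply: (stable_muln _ sV) => //.
  exact: mem_head.
have [||Qoo finQoo WE] := IH (\bigcup_j W j).
- by move=> w a ws [j _ Wa]; exists j => //; apply: sW.
- by move=> a [j _ []].
have [|J QJ] := finite_uniform_bound finQoo Wmono.
  by rewrite WE; exact: semigen_base.
have WJ j : W j `<=` W J.
  move=> a Wa; apply: (semigen_min (sW J) QJ).
  by rewrite -WE; exists j.
have [q qP] : {q : nat -> set G &
    forall j, finite_set (q j) /\ W j = semigen s (q j)}.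
  apply: (choice (P := fun j Q => finite_set Q /\ W j = semigen s Q)) => j.
  have [|Q] := IH (W j) (sW j); first by move=> a [].
  by exists Q.
exists (\bigcup_(j in `I_J.+1) [set a + v *+ j | a in q j]).
  apply: bigcup_finite; first exact: finite_II.
  by move=> j _; apply: finite_image; case: (qP j).
apply/seteqP; split=> [a Va|].
  have [n an] := VP a Va.
  have Wn : W n (a - v *+ n) by split=> //; rewrite subrK.
  (* The slice of height n coincides with the one of height min(n, J). *)
  have : W (minn n J) (a - v *+ n).
    by rewrite /minn; case: ifP => // _; apply: WJ Wn.
  case: (qP (minn n J)) => _ -> an'.
  exists (n - minn n J)%N.
  have -> : a - v *+ (n - minn n J) = a - v *+ n + v *+ minn n J.
    by rewrite mulrnBr ?geq_minl // opprB addrA addrAC.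
  elim: {1 2}s (a - v *+ n) an' => [|w s' IHs] b /=.
    by exists (minn n J) => //=; [rewrite ltnS geq_minr | exists b].
  by case=> m /IHs bm; exists m; rewrite addrAC.
apply: (@semigen_min (v :: s)) => // a [j _ [b bq <-]].
have : W j b by case: (qP j) => _ ->; apply: semigen_base.
by case.
Qed.

End Translates.

(** * Rationality of generating functions *)

Section HilbertSerre.
Variables (G : zmodType) (S : lfmonoid G).
Implicit Types (v : G) (s : seq G) (P Q U : set G).

Lemma is_polyB (E F : fseries S) : is_poly E -> is_poly F -> is_poly (E - F).
Proof.
move=> pE pF.
apply: (@sub_finite_set _ _
    ([set a | coef E a != 0] `|` [set a | coef F a != 0])).
  2: by rewrite finite_setU.
move=> a EF; have {}EF : coef E a - coef F a != 0 := EF.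
apply/orP; apply: contraNT EF.
by rewrite negb_or !negbK => /andP[/eqP -> /eqP ->]; rewrite subr0.
Qed.

Lemma is_poly_genfun Q : finite_set Q -> is_poly (genfun S Q).
Proof.
move=> finQ; apply: sub_finite_set finQ => a; apply: contra_neqP => aQ.
by rewrite /= /Defs.indic memNset // => -[].
Qed.

Lemma coef_genfun U a : U `<=` lfset S -> coef (genfun S U) a = (a \in U)%:R.
Proof.
move=> US; rewrite /= /Defs.indic; congr (_ %:R); congr nat_of_bool.
apply/idP/idP; rewrite !inE; first by case.
by move=> Ua; split=> //; exact: US.
Qed.

(** Multiplication by 1 - x^v removes U + v from U. What is left need not be
    stable under the remaining generators; a U' that covers it and may overlap
    U + v can be chosen so that both sets on the right are. *)
Lemma genfun_telescope U U' v : lfset S v -> U `<=` lfset S ->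
  (forall a, U a -> U (a + v)) -> U' `<=` U ->
  (forall a, U a -> U' a \/ U (a - v)) ->
  (1 - monom S v) * genfun S U =
    genfun S U' - genfun S (U' `&` [set a | U (a - v)]).
Proof.
move=> Sv US Uv U'U U'v; apply: fseriesP => a.
have U'S : U' `<=` lfset S by move=> b /U'U /US.
rewrite mulrBl mul1r !Defs.coefD !Defs.coefN coef_monomM // !coef_genfun //; last first.
  by move=> b [/U'S].
rewrite in_setI; case: (boolP (a \in U')) => [|]; rewrite ?inE.
  by move=> /[dup] aU' /U'U aU; rewrite (mem_set aU).
move=> /negP; rewrite inE => aU'.
rewrite subrr; apply/eqP; rewrite subr_eq0; apply/eqP.
congr (_ %:R); congr nat_of_bool.
apply/idP/idP; rewrite !inE; first by case/U'v.
by move/Uv; rewrite subrK.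
Qed.

Lemma hilbert_serre s Q : (forall v, v \in s -> lfset S v) ->
  finite_set Q -> Q `<=` lfset S ->
  is_poly (genfun S (semigen s Q) * \prod_(v <- s) (1 - monom S v)).
Proof.
elim: s Q => [|v s IH] Q sS finQ QS.
  by rewrite big_nil mulr1; exact: is_poly_genfun.
have sS' w : w \in s -> lfset S w by move=> ws; apply: sS; rewrite inE ws orbT.
have Sv : lfset S v by apply: sS; exact: mem_head.
have semigenS t P : {in t, forall w, lfset S w} -> P `<=` lfset S ->
    semigen t P `<=` lfset S.
  by move=> tS; apply: semigen_min => w a wt Sa; apply: lfsetD => //; exact: tS.
have US := semigenS (v :: s) Q sS QS.
set U := semigen (v :: s) Q in US *.
pose U' := semigen s Q.
have Uv a : U a -> U (a + v) by apply: semigen_stable; exact: mem_head.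
have U'U : U' `<=` U by move=> a U'a; exists 0%N; rewrite subr0.
have U'v a : U a -> U' a \/ U (a - v).
  move=> [[|n] an]; first by left; rewrite subr0 in an.
  by right; exists n; rewrite -addrA -opprD -mulrS.
have [||Q' finQ' Q'E] :=
    @semigen_noetherian _ s Q (U' `&` [set a | U (a - v)]) finQ.
- move=> w a ws [U'a Uav]; split; first exact: semigen_stable.
  rewrite /mkset addrAC; apply: semigen_stable Uav; by rewrite inE ws orbT.
- by move=> a [].
have -> : genfun S U * \prod_(w <- v :: s) (1 - monom S w)
   = genfun S U' * \prod_(w <- s) (1 - monom S w)
     - genfun S (semigen s Q') * \prod_(w <- s) (1 - monom S w).
  by rewrite big_cons mulrCA mulrA (genfun_telescope Sv US Uv U'U U'v) Q'E mulrBl.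
apply: is_polyB; apply: IH => //.
move=> a Q'a; apply/US/U'U.
by have : semigen s Q' a; [exact: semigen_base | rewrite -Q'E => -[]].
Qed.

End HilbertSerre.

(** * A theorem of the alternative *)

Section Dot.
Variables (R : realFieldType) (d : nat).
Implicit Types (x y u w : 'rV[R]_d) (a : R).

Definition dot u x : R := \sum_k u 0 k * x 0 k.

Fact dot_scalar u : scalar (dot u).
Proof.
move=> a x y; rewrite /dot mulr_sumr -big_split; apply: eq_bigr => k _ /=.
by rewrite !mxE mulrDr mulrCA.
Qed.
HB.instance Definition _ u :=
  GRing.isLinear.Build R 'rV[R]_d R *%R (dot u) (dot_scalar u).

Lemma dotC u x : dot u x = dot x u.
Proof. by apply: eq_bigr => k _; rewrite mulrC. Qed.

Lemma dotDr u x y : dot u (x + y) = dot u x + dot u y.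
Proof. exact: raddfD. Qed.

Lemma dotZr u a x : dot u (a *: x) = a * dot u x.
Proof. by rewrite linearZ. Qed.

Lemma dotDl u w x : dot (u + w) x = dot u x + dot w x.
Proof. by rewrite dotC dotDr !(dotC x). Qed.

Lemma dotZl a u x : dot (a *: u) x = a * dot u x.
Proof. by rewrite dotC dotZr dotC. Qed.

Lemma dot_sumr (I : Type) (s : seq I) u (F : I -> 'rV[R]_d) :
  dot u (\sum_(i <- s) F i) = \sum_(i <- s) dot u (F i).
Proof. exact: raddf_sum. Qed.

Lemma dotxx_gt0 x : x != 0 -> 0 < dot x x.
Proof.
move=> x0; rewrite lt0r sumr_ge0 ?andbT => [|k _]; last exact: sqr_ge0.
apply: contra_neq x0 => /eqP; rewrite psumr_eq0 => [/allP xx|k _]; last exact: sqr_ge0.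
apply/rowP => k; rewrite mxE; apply/eqP.
by have := xx k (mem_index_enum _); rewrite mulf_eq0 orbb.
Qed.

(** The index type lets the induction below change the vectors and keep the
    indices. *)
Definition pos_indep (I : eqType) (s : seq I) (a : I -> 'rV[R]_d) :=
  forall l : I -> R, (forall i, 0 <= l i) -> \sum_(i <- s) l i *: a i = 0 ->
  forall i, i \in s -> l i = 0.

(** Gordan's theorem, by elimination of one vector b = a j. Take u positive on
    the others; if u is not positive at b, replace each other a i by the
    combination a' i of a i and b on which u vanishes. These are again
    positively independent, and a scaled u' that is positive on them can be
    corrected by a multiple of u to a w with w b = 0 and w (a i) > 0. A large
    multiple of w plus b itself is then positive everywhere. *)
Lemma gordan_alternative (I : eqType) (s : seq I) (a : I -> 'rV[R]_d) :
  uniq s -> pos_indep s a -> exists u, forall i, i \in s -> 0 < dot u (a i).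
Proof.
elim: s a => [|j s IH] a /=; first by exists 0.
move=> /andP[js us] ia.
have neqj i : i \in s -> (i == j) = false by apply: contraTF => /eqP ->.
have sumj c (l : I -> R) : \sum_(i <- j :: s) (if i == j then c else l i) *: a i
    = c *: a j + \sum_(i <- s) l i *: a i.
  by rewrite big_cons eqxx; congr (_ + _); apply: eq_big_seq => i /neqj ->.
have aj0 : a j != 0.
  apply/eqP => aj.
  have /eqP : (if j == j then 1 else 0 : R) = 0.
    apply: (ia (fun i => if i == j then 1 else 0)) (mem_head _ _) => [i|].
      by case: ifP.
    by rewrite sumj aj scaler0 add0r big1 // => i _; rewrite scale0r.
  by rewrite eqxx oner_eq0.
have [u u0] : exists u, forall i, i \in s -> 0 < dot u (a i).
  apply: IH => // l l0 ls i si.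
  have := ia (fun i => if i == j then 0 else l i) _ _ i.
  rewrite (neqj i si); apply.
  - by move=> k; case: ifP.
  - by rewrite sumj scale0r add0r.
  - by rewrite inE si orbT.
have [ub|ub] := ltP 0 (dot u (a j)).
  by exists u => i; rewrite inE => /predU1P[->|/u0].
pose a' i := (- dot u (a j)) *: a i + dot u (a i) *: a j.
have [u' u'0] : exists u', forall i, i \in s -> 0 < dot u' (a' i).
  apply: IH => // l l0 ls i si.
  pose c := \sum_(k <- s) l k * dot u (a k).
  have lu0 k : k \in s -> 0 <= l k * dot u (a k).
    by move=> ks; rewrite mulr_ge0 // ltW // u0.
  have c0 : 0 <= c by rewrite /c big_seq; exact: sumr_ge0.
  have cE : c = 0.
    have := ia (fun i => if i == j then c else l i * - dot u (a j)) _ _ j.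
    rewrite eqxx; apply.
    - by move=> k; case: ifP => // _; rewrite mulr_ge0 // oppr_ge0.
    - rewrite sumj -[RHS]ls [LHS]addrC /c scaler_suml -big_split.
      apply: eq_bigr => k _ /=.
      by rewrite scalerDr !scalerA.
    - exact: mem_head.
  move: cE => /eqP; rewrite /c big_seq psumr_eq0 // => /allP /(_ i si).
  by rewrite si mulf_eq0 (gt_eqF (u0 i si)) orbF => /eqP.
have [w wj w0] : exists2 w, dot w (a j) = 0 &
    forall i, i \in s -> 0 < dot w (a i).
  exists ((- dot u (a j)) *: u' + dot u' (a j) *: u) => [|i /u'0].
    by rewrite dotDl !dotZl; ring.
  by rewrite /a' dotDl dotDr !dotZl !dotZr [X in _ + X]mulrC.
(* With this t, t w (a i) is at least |b (a i)| for i in s; one more w makes the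
   inequality strict. *)
pose t := \sum_(i <- s) `|dot (a j) (a i)| / dot w (a i).
exists (t *: w + a j + w) => i.
rewrite inE => /predU1P[->|si].
  by rewrite !dotDl dotZl wj mulr0 add0r addr0 dotxx_gt0.
have ti : `|dot (a j) (a i)| <= t * dot w (a i).
  rewrite -ler_pdivrMr ?w0 // /t (perm_big _ (perm_to_rem si)) big_cons lerDl.
  rewrite big_seq; apply: sumr_ge0 => k /mem_rem ks.
  by rewrite divr_ge0 // ltW // w0.
rewrite !dotDl dotZl.
have := w0 i si; have := ler_norm (- dot (a j) (a i)); rewrite normrN; lra.
Qed.

End Dot.

(** * Edges of a finitely generated cone *)

Section Hull.
Variables (R : realFieldType) (d : nat).
Implicit Types (v w x : 'rV[R]_d) (s t : seq 'rV[R]_d).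

(** A list of indices, unlike an ordinal, can be thinned out by rem and undup;
    the identity family gives the cone spanned by a list of vectors. *)
Definition hull (I : Type) (s : seq I) (a : I -> 'rV[R]_d) : set 'rV[R]_d :=
  [set x | exists2 l : I -> R,
    forall i, 0 <= l i & x = \sum_(i <- s) l i *: a i].

Lemma hull0 (I : Type) (s : seq I) (a : I -> 'rV[R]_d) : hull s a 0.
Proof. by exists (fun=> 0) => //; rewrite big1 // => i _; rewrite scale0r. Qed.

Lemma hullD (I : Type) (s : seq I) (a : I -> 'rV[R]_d) x y :
  hull s a x -> hull s a y -> hull s a (x + y).
Proof.
move=> [l l0 ->] [m m0 ->]; exists (fun i => l i + m i) => [i|].
  exact: addr_ge0.
by rewrite -big_split; apply: eq_bigr => i _; rewrite scalerDl.
Qed.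

Lemma hullZ (I : Type) (s : seq I) (a : I -> 'rV[R]_d) c x :
  0 <= c -> hull s a x -> hull s a (c *: x).
Proof.
move=> c0 [l l0 ->]; exists (fun i => c * l i) => [i|]; first exact: mulr_ge0.
by rewrite scaler_sumr; apply: eq_bigr => i _; rewrite scalerA.
Qed.

Lemma hull_gen (I : eqType) (s : seq I) (a : I -> 'rV[R]_d) i :
  uniq s -> i \in s -> hull s a (a i).
Proof.
move=> us si; exists (fun j => (j == i)%:R) => [j|]; first exact: ler0n.
rewrite (bigD1_seq i) //= eqxx scale1r big1 ?addr0 // => j /negbTE ->.
by rewrite scale0r.
Qed.

Lemma hull_min (I J : eqType) (s : seq I) (t : seq J) a b :
  (forall i, i \in s -> hull t b (a i)) -> hull s a `<=` hull t b.
Proof.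
move=> st _ [l l0 ->]; rewrite big_seq.
by elim/big_rec : _ => [|i x si tx]; [exact: hull0|apply/hullD/tx/hullZ/st].
Qed.

Lemma irredundant_generators s : uniq s -> exists s',
  [/\ uniq s', {subset s' <= s}, hull s' id = hull s id
    & forall w, w \in s' -> ~ hull (rem w s') id w].
Proof.
have [n] := ubnP (size s); elim: n s => // n IH s sn us.
have [red|irr] := pselect (exists2 w, w \in s & hull (rem w s) id w); last first.
  by exists s; split=> // w ws wh; apply: irr; exists w.
case: red => w ws wh.
have [||s' [us' s's s'E irr]] := IH (rem w s); last 1 first.
- exists s'; split=> //; first by move=> x /s's /mem_rem.
  rewrite s'E; apply/seteqP; split; apply: hull_min => x xs.
    by apply: hull_gen => //; exact: mem_rem xs.
  have [->//|xw] := eqVneq x w.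
  by apply: hull_gen; rewrite ?rem_uniq // (mem_rem_uniq _ us) inE xw.
- by rewrite size_rem //; case: (s) ws sn.
- exact: rem_uniq.
Qed.

End Hull.

Section Edges.
Variables (R : realType) (d : nat).
Implicit Types (v w x : 'rV[R]_d) (s t : seq 'rV[R]_d).

(** The theorem of the alternative is applied to the orthogonal projections of
    the other generators along w, scaled by dot w w to avoid division. A
    relation between the projections is an identity |w|^2 y = t w with y in the
    hull of the other generators: t > 0 would make w redundant, and t <= 0 puts
    both y and - y in the cone. *)
Lemma extreme_generator_exposed s w : uniq s ->
  (forall v, v \in s -> ~ hull (rem v s) id v) ->
  strictly_convex (hull s id) -> w \in s ->
  exists2 u, dot u w = 0 & forall v, v \in rem w s -> 0 < dot u v.
Proof.
move=> us irr cs ws.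
have ut : uniq (rem w s) by exact: rem_uniq.
have neq0 v : v \in s -> v != 0.
  by move=> vs; apply/eqP => v0; apply: (irr v vs); rewrite {2}v0; exact: hull0.
have ww : 0 < dot w w by apply: dotxx_gt0; exact: neq0.
have sub : hull (rem w s) id `<=` hull s id.
  by apply: hull_min => v /mem_rem vs; exact: hull_gen.
pose a v := dot w w *: v - dot v w *: w.
suff /(gordan_alternative ut)[u u0] : pos_indep (rem w s) a.
  exists (dot w w *: u - dot u w *: w) => [|v /u0].
    by rewrite -scaleNr dotDl !dotZl; ring.
  rewrite /a -!scaleNr dotDl dotDr !dotZl !dotZr (dotC v w).
  by rewrite !mulNr [X in _ < _ - X]mulrC.
move=> l l0 la.
pose y := \sum_(v <- rem w s) l v *: v.
pose t := \sum_(v <- rem w s) l v * dot v w.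
have yw : dot w w *: y = t *: w.
  apply/eqP; rewrite -subr_eq0 -la; apply/eqP.
  rewrite /y /t scaler_sumr scaler_suml -sumrB; apply: eq_bigr => v _.
  by rewrite /a scalerBr !scalerA mulrC.
have hy : hull (rem w s) id y by exists l.
have y0 : y = 0.
  have [t0|t0] := ltP 0 t.
    case: (irr w ws); rewrite [X in hull _ _ X](_ : w = (dot w w / t) *: y).
      by apply: hullZ => //; rewrite divr_ge0 // ltW.
    by rewrite mulrC -scalerA yw scalerA mulVf ?gt_eqF // scale1r.
  have : dot w w *: y = 0.
    apply: cs; first by apply: hullZ (sub _ hy); exact: ltW.
    rewrite yw -scaleNr; apply: hullZ; first by rewrite oppr_ge0.
    exact: hull_gen.
  by move/eqP; rewrite scaler_eq0 (gt_eqF ww) /= => /eqP.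
move=> v vt.
have : l v *: v = 0.
  apply: cs; first by apply: hullZ => //; apply: hull_gen => //; exact: mem_rem vt.
  move: y0; rewrite /y (bigD1_seq v) //= => /eqP; rewrite addr_eq0 => /eqP ->.
  rewrite opprK; apply: sub; exists (fun u => if u == v then 0 else l u) => [u|].
    by case: ifP.
  rewrite [RHS](bigD1_seq v) //= eqxx scale0r add0r.
  by apply: eq_bigr => u /negbTE ->.
by move/eqP; rewrite scaler_eq0 (negbTE (neq0 v (mem_rem vt))) orbF => /eqP.
Qed.

Definition ray w : set 'rV[R]_d := [set x | exists2 t : R, 0 <= t & x = t *: w].

Lemma ray_edge s w : uniq s ->
  (forall v, v \in s -> ~ hull (rem v s) id v) ->
  strictly_convex (hull s id) -> w \in s -> edges (hull s id) (ray w).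
Proof.
move=> us irr cs ws.
have [u uw u0] := extreme_generator_exposed us irr cs ws.
have u_ge0 v : v \in s -> 0 <= dot u v.
  have [->|vw] := eqVneq v w; first by rewrite uw.
  by move=> vs; rewrite ltW // u0 // (mem_rem_uniq _ us) inE vw.
have w0 : w != 0.
  by apply/eqP => w0; apply: (irr w ws); rewrite {2}w0; exact: hull0.
split.
  exists (dot u) => [x [l l0 ->]|].
    rewrite /= dot_sumr big_seq; apply: sumr_ge0 => v vs.
    by rewrite dotZr mulr_ge0 // u_ge0.
  apply/seteqP; split=> [_ [t t0 ->]|x [[l l0 ->]]].
    split; first by apply: hullZ => //; exact: hull_gen.
    by rewrite /= dotZr uw mulr0.
  rewrite (perm_big _ (perm_to_rem ws)) big_cons /= dotDr dotZr uw mulr0 add0r.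
  rewrite dot_sumr big_seq => /eqP; rewrite psumr_eq0 => [/allP ul|v vt].
    exists (l w) => //; rewrite big_seq big1 ?addr0 // => v vt.
    have := ul v vt; rewrite vt dotZr mulf_eq0 (gt_eqF (u0 v vt)) orbF.
    by move/eqP => ->; rewrite scale0r.
  by rewrite dotZr mulr_ge0 // ltW // u0.
exists <[w]>%VS => [|W]; first by rewrite dim_vline w0.
rewrite -memvE; split=> [|wW _ [t _ ->]]; last exact: memvZ.
by apply; exists 1; rewrite ?scale1r.
Qed.

Lemma edge_is_ray s rho : uniq s -> strictly_convex (hull s id) ->
  edges (hull s id) rho -> exists w, [/\ w \in s, w != 0 & rho = ray w].
Proof.
move=> us cs [[u u0 rhoE] [U dimU UP]].
have hs v : v \in s -> hull s id v by exact: hull_gen.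
have [[w [ws w0 uw]]|now] :=
    pselect (exists w, [/\ w \in s, w != 0 & u w = 0]); last first.
  have : rho `<=` [set` (0%VS : {vspace 'rV[R]_d})].
    rewrite rhoE => x [[l l0 ->]] /=.
    rewrite raddf_sum big_seq => /eqP; rewrite psumr_eq0 => [/allP ul|v vs].
      rewrite memv0 big_seq big1 // => v vs; have := ul v vs.
      rewrite vs /= linearZ /= mulf_eq0 => /orP[/eqP ->|uv].
        by rewrite scale0r.
      have [->|v0] := eqVneq v 0; first by rewrite scaler0.
      by case: now; exists v; split=> //; exact/eqP.
    by rewrite /= linearZ /= mulr_ge0 // u0 //; exact: hs.
  by move/UP; rewrite subv0 => /eqP U0; move: dimU; rewrite U0 dimv0.
have rw : rho w by rewrite rhoE; split => //; exact: hs.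
have rU : rho `<=` [set` U] by apply/UP.
exists w; split=> //; apply/seteqP; split=> [x rx|_ [t t0 ->]]; last first.
  rewrite rhoE; split; first by apply: hullZ => //; exact: hs.
  by rewrite /= linearZ /= uw mulr0.
have Uw : U = <[w]>%VS.
  apply/esym/eqP; rewrite eqEdim -memvE dim_vline w0 dimU leqnn andbT.
  exact: rU rw.
have /vlineP[t xt] : x \in <[w]>%VS by rewrite -Uw; exact: rU rx.
exists t => //; rewrite leNgt; apply/negP => t0.
move/eqP: w0; apply; apply: cs; first exact: hs.
have -> : - w = (- t^-1) *: x by rewrite xt scalerA mulNr mulVf ?lt_eqF // scaleN1r.
apply: hullZ; first by rewrite oppr_ge0 invr_le0 ltW.
by move: rx; rewrite rhoE => -[].
Qed.

End Edges.

(** * Lattice points of a cone *)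

Section Lattice.
Variables (R : realType) (d : nat) (N : set 'rV[R]_d).
Hypothesis hN : full_lattice N.
Implicit Types (v w x y nu : 'rV[R]_d).

Lemma lattice0 : N 0.
Proof.
by case: hN => B _ ->; exists 0 => //; rewrite /int_pt map_mx0 mul0mx.
Qed.

Lemma latticeB x y : N x -> N y -> N (x - y).
Proof.
case: hN => B _ -> [a _ <-] [b _ <-]; exists (a - b) => //.
by rewrite /int_pt map_mxB mulmxBl.
Qed.

Lemma latticeD x y : N x -> N y -> N (x + y).
Proof.
move=> Nx Ny; rewrite -[y]opprK -[- y]sub0r.
by do !apply: latticeB => //; exact: lattice0.
Qed.

Lemma latticeMn x n : N x -> N (x *+ n).
Proof.
by move=> Nx; elim: n => [|n IH]; [exact: lattice0|rewrite mulrS; exact: latticeD].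
Qed.

Lemma lattice_sum (I : eqType) (r : seq I) (F : I -> 'rV[R]_d) :
  (forall i, i \in r -> N (F i)) -> N (\sum_(i <- r) F i).
Proof.
move=> NF; rewrite big_seq; elim/big_rec: _ => [|i x ir]; first exact: lattice0.
by apply: latticeD; exact: NF.
Qed.

(** Fix a coordinate of w, with respect to a basis of N, that does not vanish,
    and let M be its absolute value. Then t w can only be in N if t M is an
    integer, and a division with remainder by the least positive such integer
    shows that the corresponding point generates all the others. *)
Lemma ray_lattice_generator w : N w -> w != 0 ->
  exists2 nu, nu != 0 & ray w `&` N = [set nu *+ k | k in [set: nat]].
Proof.
move=> Nw w0.
have [M M0 tM] : exists2 M, (0 < M)%N &
    forall t : R, 0 <= t -> N (t *: w) -> exists n, t = n%:R / M%:R.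
  case: hN => B Bu NE; move: Nw; rewrite NE => -[c _ cw].
  have [j cj] : exists j, c 0 j != 0.
    apply/existsP; apply: contra_neqT w0; rewrite negb_exists => /forallP c0.
    rewrite -cw [c](_ : _ = 0) ?/int_pt ?map_mx0 ?mul0mx //.
    by apply/rowP => j; rewrite mxE; apply/eqP; rewrite -[_ == _]negbK.
  exists (absz (c 0 j)); rewrite ?absz_gt0 // => t t0 [b _ bt].
  have tcb : t *: int_pt R c = int_pt R b.
    by apply: (can_inj (mulmxK Bu)); rewrite bt -scalemxAl cw.
  exists (absz (b 0 j)); apply/eqP.
  rewrite -[t]ger0_norm // !natr_absz !intr_norm.
  have -> : (b 0 j)%:~R = t * (c 0 j)%:~R :> R.
    by have := congr1 (fun A : 'rV[R]_d => A 0 j) tcb; rewrite !mxE.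
  by rewrite normrM mulfK // normr_eq0 intr_eq0.
pose p n := (0 < n)%N && `[< N ((n%:R / M%:R : R) *: w) >].
have Mu : M%:R != 0 :> R by rewrite pnatr_eq0 -lt0n.
have exp : exists n, p n.
  by exists M; rewrite /p M0 divff // scale1r; apply/asboolP.
case: (ex_minnP exp) => k /andP[k0 /asboolP Nk] kmin.
exists ((k%:R / M%:R : R) *: w).
  by rewrite scaler_eq0 negb_or w0 andbT mulf_neq0 ?invr_neq0 // pnatr_eq0 -lt0n.
apply/seteqP; split=> [x [[t t0 ->] Nt]|_ [q _ <-]]; last first.
  split; last exact: latticeMn.
  by exists (k%:R / M%:R *+ q); rewrite ?mulrn_wge0 ?divr_ge0 // scalerMnl.
have [n tn] := tM t t0 Nt.
exists (n %/ k)%N => //.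
suff kn : (n %% k = 0)%N.
  rewrite tn scalerMnl {2}(divn_eq n k) kn addn0 natrM -mulr_natl.
  by congr (_ *: _); ring.
apply/eqP; rewrite -leqn0 leqNgt; apply/negP => r0.
have := ltn_pmod n k0; rewrite ltnNge => /negP; apply; apply: kmin.
rewrite /p r0; apply/asboolP.
have -> : ((n %% k)%:R / M%:R : R) *: w
    = t *: w - ((k%:R / M%:R : R) *: w) *+ (n %/ k)%N.
  rewrite tn {2}(divn_eq n k) scalerMnl -scalerBl natrD natrM -mulr_natl.
  by congr (_ *: _); ring.
by apply: latticeB => //; exact: latticeMn.
Qed.

(** The closed cube of coefficients, instead of the half-open one, suffices for
    finiteness. *)
Definition zonotope (I : Type) (r : seq I) (nu : I -> 'rV[R]_d) : set 'rV[R]_d :=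
  [set x | exists2 l : I -> R,
    forall i, 0 <= l i <= 1 & x = \sum_(i <- r) l i *: nu i].

(** The coordinates with respect to a basis of N of a point of the zonotope are
    bounded by the sums of the absolute values of those of the nu i. *)
Lemma finite_lattice_zonotope (I : choiceType) (r : seq I) (nu : I -> 'rV[R]_d) :
  (forall i, i \in r -> N (nu i)) ->
  finite_set (N `&` zonotope r nu).
Proof.
case: hN => B Bu -> Nnu.
have [c cE] : {c : I -> 'rV[int]_d &
    forall i, i \in r -> nu i = int_pt R (c i) *m B}.
  apply: (choice (P := fun i b => i \in r -> nu i = int_pt R b *m B)) => i.
  have [/Nnu[b _ bE]|ir] := boolP (i \in r); first by exists b.
  by exists 0.
pose m := (\sum_(i <- r) \sum_j absz (c i ord0 j))%N.
apply: (@sub_finite_set _ _ ((fun b => int_pt R b *m B) @`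
    [set b : 'rV[int]_d | forall j, `|b ord0 j| <= m%:Z])); last first.
  by apply: finite_image; exact: finite_box.
move=> _ [[b _ <-] [l l01 bE]]; exists b => // j.
have {}bE : int_pt R b = \sum_(i <- r) l i *: int_pt R (c i).
  apply: (can_inj (mulmxK Bu)); rewrite bE mulmx_suml; apply: eq_big_seq => i ir.
  by rewrite cE // scalemxAl.
rewrite -(ler_int R) intr_norm.
have -> : (b ord0 j)%:~R = \sum_(i <- r) l i * (c i 0 j)%:~R.
  have := congr1 (fun M : 'rV[R]_d => M 0 j) bE; rewrite mxE => ->.
  by rewrite summxE; apply: eq_bigr => i _; rewrite !mxE.
apply: le_trans (ler_norm_sum _ _ _) _.
rewrite /m -pmulrn natr_sum; apply: ler_sum => i _.
have /andP[l0 l1] := l01 i.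
rewrite normrM (ger0_norm l0) -intr_norm -natr_absz.
apply: le_trans (_ : (absz (c i ord0 j))%:R <= _); first by rewrite ler_piMl.
by rewrite ler_nat (bigD1 j) //= leq_addr.
Qed.

Lemma fractional_decomposition (I : choiceType) (r : seq I) (nu : I -> 'rV[R]_d) x :
  (forall i, i \in r -> N (nu i)) -> N x -> hull r nu x ->
  exists (n : I -> nat) y,
    [/\ x = y + \sum_(i <- r) nu i *+ n i, N y & zonotope r nu y].
Proof.
move=> Nnu Nx [l l0 xE].
pose m i := l i - (Num.trunc (l i))%:R.
have m01 i : 0 <= m i <= 1.
  have /andP[h1 h2] := truncn_itv (l0 i).
  by rewrite /m subr_ge0 h1 lerBlDr -natr1 addrC in h2 *; rewrite ltW.
exists (fun i => Num.trunc (l i)), (\sum_(i <- r) m i *: nu i).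
have xmE : x = \sum_(i <- r) m i *: nu i + \sum_(i <- r) nu i *+ Num.trunc (l i).
  rewrite xE -big_split; apply: eq_bigr => i _ /=.
  by rewrite /m scalerBl scaler_nat subrK.
split=> //; last by exists m.
have -> : \sum_(i <- r) m i *: nu i = x - \sum_(i <- r) nu i *+ Num.trunc (l i).
  by rewrite xmE addrK.
by apply: latticeB => //; apply: lattice_sum => i ir; apply: latticeMn; exact: Nnu.
Qed.

End Lattice.

(** Translation by - v maps a neighbourhood of x + v to one of x, and preserves
    the affine hull of T because that hull contains 0 and v. *)
Lemma relintD (R : realType) (d : nat) (T : set 'rV[R]_d) x v :
  T 0 -> (forall a b, T a -> T b -> T (a + b)) ->
  relint T x -> T v -> relint T (x + v).
Proof.
move=> T0 TD [Tx nx] Tv; split; first exact: TD.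
have cont : {for (x + v), continuous (fun y : 'rV[R]_d => y - v)}.
  by apply: (@cvgB _ _ _ (nbhs (x + v))); [exact: cvg_id|exact: cvg_cst].
have := cont (fun y => aff_hull T y -> T y); rewrite addrK => /(_ nx) near_v.
apply: (@filterS _ (nbhs (x + v)) _ _ _ _ near_v) => y yT [n [p [l [pT l1 yE]]]].
rewrite -(subrK v y); apply: TD => //; apply: yT.
(* y - v is an affine combination: add 1 * 0 and (-1) * v to the one for y. *)
exists n.+2, (fun i => if unlift ord0 i is Some j then
                         if unlift ord0 j is Some k then p k else v else 0).
exists (fun i => if unlift ord0 i is Some j then
                   if unlift ord0 j is Some k then l k else -1 else 1).
split=> [i||]; first by case: (unlift _ i) => // j; case: (unlift _ j).
all: rewrite !big_ord_recl !unlift_none liftK unlift_none /=.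
  by under eq_bigr do rewrite !liftK; rewrite l1; ring.
by under eq_bigr do rewrite !liftK; rewrite scaler0 add0r scaleN1r -yE addrC.
Qed.

(** * The generating function of the projected points *)

Lemma lattice_hom_sum (R : realType) (d r : nat) (N : set 'rV[R]_d)
    (pi : 'rV[R]_d -> 'rV[int]_r) (I : eqType) (s : seq I) (nu : I -> 'rV[R]_d)
    (n : I -> nat) y :
  full_lattice N -> lattice_hom N pi -> (forall i, i \in s -> N (nu i)) -> N y ->
  pi (y + \sum_(i <- s) nu i *+ n i) = pi y + \sum_(i <- s) pi (nu i) *+ n i.
Proof.
move=> hN hpi; have N0 := lattice0 hN.
have pi0 : pi 0 = 0.
  by apply: (addIr (pi 0)); rewrite add0r -hpi // addr0.
have piMn x k : N x -> pi (x *+ k) = pi x *+ k.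
  move=> Nx; elim: k => [|k IH] //.
  by rewrite !mulrS hpi ?IH //; exact: latticeMn.
move=> Nnu Ny; elim: s Nnu => [|i s IH] Nnu; first by rewrite !big_nil !addr0.
have Ni : N (nu i *+ n i) by apply: latticeMn => //; apply: Nnu; exact: mem_head.
have Ns j : j \in s -> N (nu j) by move=> js; apply: Nnu; rewrite inE js orbT.
rewrite !big_cons addrCA hpi // ?IH // ?piMn 1?addrCA //.
- by apply: Nnu; exact: mem_head.
- apply: latticeD => //; apply: lattice_sum => // j js.
  by apply: latticeMn => //; exact: Ns.
Qed.

Section LatticeCone.
Variables (R : realType) (d : nat) (N tau : set 'rV[R]_d).
Hypotheses (hN : full_lattice N) (htau : rational_cone N tau).
Hypothesis hconv : strictly_convex tau.

Lemma irredundant_lattice_generators : exists s,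
  [/\ uniq s, forall v, v \in s -> N v, tau = hull s id
    & forall w, w \in s -> ~ hull (rem w s) id w].
Proof.
case: htau => n [v [Nv tauE]].
have [s [us sv sE irr]] := irredundant_generators (undup_uniq (codom v)).
exists s; split=> //.
  by move=> w /sv; rewrite mem_undup => /codomP[i ->].
rewrite sE tauE -[LHS]/(hull (index_enum 'I_n) v).
apply/seteqP; split; apply: hull_min => w.
  move=> _; apply: (@hull_gen _ _ _ _ id); first exact: undup_uniq.
  by rewrite mem_undup codom_f.
rewrite mem_undup => /codomP[i ->].
by apply: hull_gen; rewrite ?index_enum_uniq ?mem_index_enum.
Qed.

(** Every edge is the ray of some generator of tau, which lies in N, so that the
    points of N on it are the multiples of a single one. *)
Lemma edge_genP rho : edges tau rho ->
  [/\ edge_gen N rho != 0, tau (edge_gen N rho), N (edge_gen N rho)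
    & rho `&` N = [set edge_gen N rho *+ k | k in [set: nat]]].
Proof.
move=> erho; have [s [us sN tauE _]] := irredundant_lattice_generators.
have cs := hconv; have es := erho; rewrite tauE in cs es.
have [w [ws w0 rhoE]] := edge_is_ray us cs es.
have [nu nu0 nuE] := ray_lattice_generator hN (sN _ ws) w0.
have genE : rho `&` N = [set edge_gen N rho *+ k | k in [set: nat]].
  by apply: (@xgetPex _ 0 [set v | rho `&` N = [set v *+ k | k in [set: nat]]]);
    exists nu; rewrite /mkset rhoE.
have [rg Ng] : (rho `&` N) (edge_gen N rho) by rewrite genE; exists 1%N.
split=> //; last by case: erho => -[u _ ->] _ in rg *; case: rg.
apply: contra_neq nu0 => g0.
have : (rho `&` N) nu by rewrite rhoE nuE; exists 1%N.
by rewrite genE g0 => -[k _ <-]; rewrite mul0rn.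
Qed.

Lemma cone_generated_by_edges :
  tau `<=` hull (fset_set (edges tau)) (edge_gen N).
Proof.
have [s [us sN tauE irr]] := irredundant_lattice_generators.
rewrite {1}tauE; apply: hull_min => w ws.
have ew : edges tau (ray w) by rewrite tauE; apply: ray_edge => //; rewrite -tauE.
have [_ _ _ gE] := edge_genP ew.
have : (ray w `&` N) w by split; [exists 1; rewrite ?scale1r|exact: sN].
rewrite gE => -[k _ <-]; rewrite -scaler_nat; apply: hullZ => //.
apply: hull_gen; first exact: fset_uniq.
by rewrite in_fset_set ?inE //; exact: finite_edges htau.
Qed.

End LatticeCone.

Theorem theorem12p4 (R : realType) (d r : nat) (N tau : set 'rV[R]_d)
    (pi : 'rV[R]_d -> 'rV[int]_r) (piR : {linear 'rV[R]_d -> 'rV[R]_r})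
    (hr : (1 <= r <= d)%N) (hN : full_lattice N)
    (htau : rational_cone N tau) (hconv : strictly_convex tau)
    (hpi : lattice_hom N pi) (hpiR : real_extension N pi piR)
    (hker : tau `&` [set x | piR x = 0] = [set 0]) :
  let S := lattice_monoid (rational_cone_image piR htau)
                          (strictly_convex_image htau hconv hker) in
  let A := relint tau `&` N in
  let Abar := pi @` A in
  exists2 P : fseries S, is_poly P &
    genfun S Abar =
      P * \big[*%R/1]_(rho \in edges tau) (1 - monom S (pi (edge_gen N rho)))^-1.
Proof.
move=> S A Abar.
have finE := finite_edges htau.
pose E : seq (set 'rV[R]_d) := fset_set (edges tau).
pose nu := edge_gen N.
have Eedge rho : rho \in E -> edges tau rho by rewrite /E in_fset_set // inE.
have nuN rho : rho \in E -> N (nu rho) by case/Eedge/(edge_genP hN htau hconv).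
have nutau rho : rho \in E -> tau (nu rho).
  by case/Eedge/(edge_genP hN htau hconv).
have piS x : tau x -> N x -> lfset S (pi x).
  by move=> tx Nx; exists x => //; exact: hpiR.
pose s := map (fun rho => pi (nu rho)) E.
have sS v : v \in s -> lfset S v.
  by move=> /mapP[rho rE ->]; apply: piS; [exact: nutau|exact: nuN].
have AbarS : Abar `<=` lfset S by move=> _ [x [[tx _] Nx] <-]; exact: piS.
have sAbar : stable s Abar.
  move=> v _ /mapP[rho rE ->] [x [rx Nx] <-]; exists (x + nu rho); last first.
    by rewrite hpi //; exact: nuN.
  split; last by apply: latticeD => //; exact: nuN.
  apply: relintD rx (nutau _ rE); first exact: cone0 htau.
  exact: coneD htau.
have finP : finite_set (pi @` (N `&` zonotope E nu)).
  by apply: finite_image; exact: finite_lattice_zonotope.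
have AbarP : Abar `<=` semigen s (pi @` (N `&` zonotope E nu)).
  move=> _ [x [[tx _] Nx] <-].
  have [|n [y [-> Ny yz]]] := @fractional_decomposition _ _ _ hN _ E nu x nuN Nx.
    exact: cone_generated_by_edges tx.
  by rewrite (lattice_hom_sum _ hN hpi) //; apply: semigen_sum; exists y.
have [Q finQ AbarE] := semigen_noetherian finP sAbar AbarP.
have QS : Q `<=` lfset S.
  by move=> a Qa; apply: AbarS; rewrite AbarE; exact: semigen_base.
exists (genfun S Abar * \prod_(v <- s) (1 - monom S v)).
  by rewrite AbarE; exact: hilbert_serre.
rewrite fsbig_finite // -mulrA big_map -big_split big1_seq ?mulr1 // => rho /= rE.
(* If - pi (nu rho) were in the strictly convex image of tau, then nu rho would
   be a nonzero point of tau in the kernel of piR. *)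
apply: divrr; apply: monom_unit; first by apply: sS; exact: map_f.
have [nu0 _ _ _] := edge_genP hN htau hconv (Eedge _ rE).
move=> SN; case/eqP: nu0.
have piR0 : piR (nu rho) = 0.
  apply: (strictly_convex_image htau hconv hker).
    by exists (nu rho) => //; exact: nutau.
  by rewrite (hpiR _ (nuN _ rE)) /int_pt -map_mxN.
have : (tau `&` [set x | piR x = 0]) (nu rho) by split=> //; exact: nutau.
by rewrite hker.
Qed.
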